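(* Let $n\in\mathbb{N}$, let $\lambda$ be a partition of $n$ and let $U\in\mathrm{SYT}(\lambda)$. For all cells $x\in\lambda$ and for all entries $1\le b\le n$ we have the recursion $$(n-b)\,\Delta_U(b,x)=(n-1)!-\omega_U(b,x)+\sum_{a=1}^{b-1}\Delta_U(a,x).$$
   Context: A partition $\lambda=(\lambda_1\ge\lambda_2\ge\dots)$ of $n$ is identified with its Young diagram $\{(i,j): i\ge 1,\ 1\le j\le\lambda_i\}$ (English convention: row $i$, column $j$). A tableau of shape $\lambda$ is a bijection $T:\lambda\to\{1,\dots,n\}$; $\mathrm{T}(\lambda)$ is the set of all tableaux. $\mathrm{SYT}(\lambda)\subseteq \mathrm{T}(\lambda)$ is the set of standard Young tableaux, i.e. tableaux increasing along rows from left to right and along columns from top to bottom. For a cell $x=(i,j)\in\lambda$ put $N^-(x)=N_\lambda^-(x)=\{(i-1,j),(i,j-1)\}\cap\lambda$ and $N^+(x)=N_\lambda^+(x)=\{(i+1,j),(i,j+1)\}\cap\lambda$. Novelli--Pak--Stoyanovskii algorithm corresponding to $U\in\mathrm{SYT}(\lambda)$: order the cells by $x\prec_U y :\Leftrightarrow U(x)<U(y)$. Given $T\in\mathrm{T}(\lambda)$ set $T_0=T$. If $T_s$ is not a standard Young tableau, let $x$ be the $\prec_U$-maximal cell with $N_\lambda^+(x)\neq\emptyset$ and $T_s(x)>\min\{T_s(y):y\in N_\lambda^+(x)\}$, and let $T_{s+1}$ be obtained from $T_s$ by exchanging the entry $T_s(x)$ with the entry $\min\{T_s(y):y\in N_\lambda^+(x)\}$.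 The process stops at the first tableau $T_r$ which is standard; write $r_U(T)=r$ and $\varphi_U(T)=T_r$. Local exchange numbers: for $1\le a<b\le n$ and $x,y\in\lambda$ let $m_U(a,b,x,y)$ be the number of $T\in\mathrm{T}(\lambda)$ such that for some $1\le i\le r_U(T)$ we have $T_{i-1}(x)=a$, $T_{i-1}(y)=b$, $T_i(x)=b$, $T_i(y)=a$. It is known that this does not depend on the choice of $b>a$, and one writes $m_U(a,x,y)=m_U(a,b,x,y)$ for any $b$ with $a<b\le n$. Signed exit number of the entry $b$ at the cell $x$: $$\Delta_U(b,x)=\sum_{y\in N^-(x)}m_U(b,x,y)-\sum_{y\in N^+(x)}m_U(b,y,x).$$ (For $b=n$ the quantity $\Delta_U(n,x)$ is not defined in this way; the product $(n-n)\,\Delta_U(n,x)$ is read as $0$.) Let $\omega_U(b,x)$ be the number of tableaux $T\in\mathrm{T}(\lambda)$ with $\varphi_U(T)(x)=b$. *)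

(* Defs.v *)
From mathcomp Require Import all_boot all_order all_algebra.
Set Implicit Arguments.
Unset Strict Implicit.
Unset Printing Implicit Defensive.

(* A partition of n is the weakly decreasing list of its positive parts. *)
Definition is_partition (n : nat) (la : seq nat) : bool :=
  [&& sorted geq la, 0 \notin la & sumn la == n].

(* Rows and columns are numbered from 0. *)
Definition cell (la : seq nat) := {i : 'I_(size la) & 'I_(nth 0 la i)}.
Definition row (la : seq nat) (x : cell la) : nat := tag x.
Definition col (la : seq nat) (x : cell la) : nat := tagged x.

Definition Nminus (la : seq nat) (x : cell la) : {set cell la} :=
  [set y | ((row y).+1 == row x) && (col y == col x)
        || (row y == row x) && ((col y).+1 == col x)].
Definition Nplus (la : seq nat) (x : cell la) : {set cell la} :=
  [set y | (row y == (row x).+1) && (col y == col x)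
        || (row y == row x) && (col y == (col x).+1)].

(* The element k of 'I_n stands for the entry k + 1, see [entry]. *)
Definition filling (n : nat) (la : seq nat) := {ffun cell la -> 'I_n}.
Definition entry (n : nat) (la : seq nat) (T : filling n la) (x : cell la) :
  nat := (T x).+1.

Definition is_tableau (n : nat) (la : seq nat) (T : filling n la) : bool :=
  injectiveb T && [forall k, k \in codom T].
Definition is_SYT (n : nat) (la : seq nat) (T : filling n la) : bool :=
  is_tableau T &&
  [forall x, forall y,
     ((row x == row y) && (col x < col y)
      || (col x == col y) && (row x < row y)) ==> (entry T x < entry T y)].

Section NPS.
Variables (n : nat) (la : seq nat).
Implicit Types (U T : filling n la) (x y z : cell la).

(* The cell of N^+(x) with the smallest entry; None iff N^+(x) is empty. *)
Definition min_Nplus T x : option (cell la) :=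
  [pick y in Nplus x | [forall z in Nplus x, entry T y <= entry T z]].

Definition violates T x : bool :=
  if min_Nplus T x is Some y then entry T y < entry T x else false.

Definition active_cell U T : option (cell la) :=
  [pick x | violates T x & [forall z, violates T z ==> (entry U z <= entry U x)]].

Definition exchange T x y : filling n la :=
  [ffun z => if z == x then T y else if z == y then T x else T z].

(* On a standard tableau no cell violates, and [nps_step] is the identity. *)
Definition nps_step U T : filling n la :=
  if active_cell U T is Some x then
    if min_Nplus T x is Some y then exchange T x y else T
  else T.

Definition nps_iter U T (s : nat) : filling n la := iter s (nps_step U) T.

(* [orbit] lists T_0, T_1, ... without repetition, so this is the least s
   with T_s standard. *)
Definition nps_rounds U T : nat :=
  find (@is_SYT n la) (orbit (nps_step U) T).

Definition nps U T : filling n la := nps_iter U T (nps_rounds U T).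

Definition exchange_number U (a b : nat) x y : nat :=
  #|[set T | is_tableau T &
      [exists i : 'I_(nps_rounds U T),
        [&& entry (nps_iter U T i) x == a,
            entry (nps_iter U T i) y == b,
            entry (nps_iter U T i.+1) x == b &
            entry (nps_iter U T i.+1) y == a]]]|.

(* m a x y = m_U(a,b,x,y) for some b with a < b <= n. The right-hand side does
   not depend on b; asking for just one b keeps that fact out of the
   hypotheses, and leaves m n arbitrary. *)
Definition is_local_exchange_number U (m : nat -> cell la -> cell la -> nat) :
  Prop :=
  forall a x y, 0 < a < n ->
    exists2 b, a < b <= n & m a x y = exchange_number U a b x y.

Definition omega U (b : nat) x : nat :=
  #|[set T | is_tableau T & entry (nps U T) x == b]|.

Definition signed_exit (m : nat -> cell la -> cell la -> nat) (b : nat) x :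
  int :=
  (\sum_(y in Nminus x) (m b x y)%:Z - \sum_(y in Nplus x) (m b y x)%:Z)%R.

End NPS.

(* Main.v *)
Require Import Defs.
From mathcomp Require Import all_boot all_order all_algebra.
From mathcomp Require Import perm zify.
Set Implicit Arguments.
Unset Strict Implicit.
Unset Printing Implicit Defensive.
Import GRing.Theory.
Local Open Scope ring_scope.

(** Follow one entry [b] at one cell [x] through a run of the algorithm. Every
step exchanges the active cell [p] with a neighbour [y] in [Nplus p] that holds
a smaller entry, so [b] leaves or enters [x] either as the smaller entry, moving
up or left against some [c > b], or as the larger one, moving down or right
against some [a < b]. Each exchange of [b] as the smaller entry is counted by
[signed_exit] at [b], and each exchange of [b] as the larger entry is counted,
with the opposite sign, by [signed_exit] at [a] ([step_flow]). Summed over all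
steps and all tableaux, the net losses of [b] at [x] telescope to the number [(n-1)!] of
tableaux with [b] at [x] minus [omega U b x] ([exit_balance]). Since exchange
numbers do not depend on the larger entry, the [n - b] values [c > b] contribute
equally, and the recursion follows.

Two facts about the run are needed. An exchange number counts tableaux, not
exchanges, so the same exchange must not occur twice in a run ([swaps_uniq]);
and the exchange number for [a < b] must be the same for all [b]
([exchange_number_indep]). Both rest on the invariant [sliding]: the run is
divided into phases, one for each cell [u] in decreasing order of [U], and in
the phase of [u] the initial entry of [u] slides through the cells after [u],
which are sorted apart from the sliding entry. So an entry acts as the larger
one only in the phase of its own initial cell, and there it meets increasing
smaller entries ([spent]). This gives uniqueness. For the independence,
exchange the adjacent values [c] and [d = c +- 1] in a tableau. As long as an
exchange of [c], as the larger entry, with some [a < c, d] is still to come, no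
comparison of [c] with [d] is decisive, so the two runs agree up to that
relabelling ([relabel_step], [relabel_swaps]). *)

(** * Neighbours, violations and single steps *)

Section Sliding.
Local Open Scope nat_scope.
Variables (n : nat) (la : seq nat).
Implicit Types (S T : filling n la) (x y z w u p : cell la).

Lemma mem_Nminus x y : (y \in Nminus x) = (x \in Nplus y).
Proof.
by rewrite !inE [Defs.row x == _]eq_sym [Defs.col y == _]eq_sym
  [Defs.row y == _]eq_sym [(Defs.col y).+1 == _]eq_sym.
Qed.

Lemma standard_Nplus T x y : is_SYT T -> y \in Nplus x -> T x < T y.
Proof.
case/andP=> _ /forallP/(_ x)/forallP/(_ y)/implyP H; rewrite inE => xy.
rewrite -ltnS; apply: H.
by case/orP: xy => /andP[/eqP-> /eqP->]; rewrite eqxx ltnSn ?orbT.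
Qed.

Lemma tableau_inj T : is_tableau T -> injective T.
Proof. by case/andP=> /injectiveP. Qed.

Lemma min_NplusP T x y : injective T ->
  (min_Nplus T x = Some y) <->
  (y \in Nplus x /\ forall z, z \in Nplus x -> T y <= T z).
Proof.
move=> injT; rewrite /min_Nplus; case: pickP => [w /andP[wx /forallP wmin]|no].
  have wm z : z \in Nplus x -> T w <= T z.
    by move=> zx; have := wmin z; rewrite zx /= ltnS.
  split=> [[<-] //|[yx ymin]]; congr Some; apply/injT/val_inj/eqP.
  by rewrite eqn_leq wm // ymin.
split=> // -[yx ymin]; have /andP[] := negbT (no y); split=> //.
by apply/forallP=> z; apply/implyP=> zx; rewrite ltnS ymin.
Qed.

Arguments min_NplusP {T x y}.

Lemma violatesP T x : injective T ->
  reflect (exists2 y, y \in Nplus x & T y < T x) (violates T x).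
Proof.
move=> injT; rewrite /violates; apply: (iffP idP).
  case E: min_Nplus => [y|//]; rewrite ltnS => yx.
  by exists y => //; case/(min_NplusP injT): E.
case=> y yx ltyx; have [w wx wmin] := arg_minnP (fun w => T w : nat) yx.
have /(min_NplusP injT)-> : w \in Nplus x /\
    forall z, z \in Nplus x -> T w <= T z.
  by split.
by rewrite ltnS; apply: leq_ltn_trans ltyx; apply: wmin.
Qed.

Arguments violatesP {T x}.

Variable U : filling n la.
Hypothesis stdU : is_SYT U.
Let injU : injective U. Proof. by case/andP: stdU => /tableau_inj. Qed.
Let U_Nplus x y : y \in Nplus x -> U x < U y.
Proof. exact: standard_Nplus. Qed.

Lemma active_cellP T x :
  (active_cell U T = Some x) <->
  (violates T x /\ forall z, violates T z -> U z <= U x).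
Proof.
rewrite /active_cell; case: pickP => [w /andP[vw /forallP wmax]|no].
  have wm z : violates T z -> U z <= U w.
    by move=> vz; have := wmax z; rewrite vz /= ltnS.
  split=> [[<-] //|[vx xmax]]; congr Some; apply/injU/val_inj/eqP.
  by rewrite eqn_leq wm // xmax.
split=> // -[vx xmax]; have /andP[] := negbT (no x); split=> //.
by apply/forallP=> z; apply/implyP=> vz; rewrite ltnS xmax.
Qed.

Arguments active_cellP {T x}.

Lemma nps_step_exchange T x y : injective T ->
    y \in Nplus x -> (forall z, z \in Nplus x -> T y <= T z) -> T y < T x ->
    (forall z, violates T z -> U z <= U x) ->
  nps_step U T = exchange T x y.
Proof.
move=> injT yx ymin ltyx xmax; rewrite /nps_step.
have /active_cellP-> : violates T x /\ forall z, violates T z -> U z <= U x.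
  by split=> //; apply/violatesP => //; exists y.
by have /(min_NplusP injT)-> : y \in Nplus x /\
  forall z, z \in Nplus x -> T y <= T z by split.
Qed.

Lemma nps_step_standard T : is_SYT T -> nps_step U T = T.
Proof.
move=> stdT; rewrite /nps_step; case E: active_cell => [x|//].
have injT : injective T by case/andP: stdT => /tableau_inj.
case/active_cellP: E => /(violatesP injT)[y /(standard_Nplus stdT)].
by move=> lt1 lt2; have := ltn_trans lt1 lt2; rewrite ltnn.
Qed.

Lemma exchange_tperm T x y z : exchange T x y z = T (tperm x y z).
Proof.
rewrite ffunE; case: tpermP => [->|->|/eqP/negPf-> /eqP/negPf-> //].
  by rewrite eqxx.
by rewrite eqxx; case: eqP => [->|].
Qed.

Lemma exchange_inj T x y : injective T -> injective (exchange T x y).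
Proof. by move=> injT z w; rewrite !exchange_tperm => /injT/perm_inj. Qed.

(** * Phases of the run *)

(** The tableau [S], reached from the initial tableau [T], is in the phase of
the cell [u]: cells before [u] are untouched, the initial entry of [u] is now at
[p], and the cells from [u] on are sorted except that the entry at [p] may be
too large. The last clause is the jeu de taquin condition: the predecessors of
[p] from [u] on are smaller than its successors, so that the order survives when
the smallest successor moves into [p]. Cells before, from and after [u] refer to
the order given by [U]. *)
Definition sliding T S u p : Prop :=
  [/\ injective S,
      forall z, U z < U u -> S z = T z,
      S p = T u /\ U u <= U p,
      forall z y, z != p -> U u <= U z -> y \in Nplus z -> S z < S y
    & forall w y, p \in Nplus w -> U u <= U w -> y \in Nplus p -> S w < S y].

(** The phase of [u] is not finished: the entry at [p] is to be exchanged with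
the one at [y]. *)
Definition slides T S u p y : Prop :=
  [/\ sliding T S u p, y \in Nplus p, forall z, z \in Nplus p -> S y <= S z
    & S y < S p].

Lemma sliding_violates T S u p z :
  sliding T S u p -> U u <= U z -> violates S z -> z = p.
Proof.
case=> injS _ _ sorted _ uz /(violatesP injS)[y yz lty].
apply/eqP/negPn/negP=> zp.
by have := ltn_trans lty (sorted _ _ zp uz yz); rewrite ltnn.
Qed.

Lemma slides_step T S u p y :
  slides T S u p y -> nps_step U S = exchange S p y.
Proof.
case=> sl yp ymin ltyp; have [injS _ [_ up] _ _] := sl.
apply: nps_step_exchange => // z vz.
have [uz|/ltnW zu] := leqP (U u) (U z).
  by rewrite (sliding_violates sl uz vz).
exact: leq_trans zu up.
Qed.

Lemma slides_next T S u p y :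
  slides T S u p y -> sliding T (exchange S p y) u y.
Proof.
case=> [[injS old [Sp up] sorted around] yp ymin ltyp].
have Upy := U_Nplus yp.
have yNp : y != p by apply: contraTneq Upy => ->; rewrite ltnn.
have Ey : exchange S p y y = S p by rewrite ffunE eqxx (negPf yNp).
have Ep : exchange S p y p = S y by rewrite ffunE eqxx.
have Ez z : z != p -> z != y -> exchange S p y z = S z.
  by move=> zp zy; rewrite ffunE (negPf zp) (negPf zy).
split.
- exact: exchange_inj.
- move=> z zu; rewrite Ez; first exact: old.
    by apply: contraTneq zu => ->; rewrite -leqNgt.
  by apply: contraTneq zu => ->; rewrite -leqNgt (leq_trans up (ltnW Upy)).
- by rewrite Ey; split=> //; apply: leq_trans up (ltnW Upy).
- move=> z w zy uz wz.
  have [zp|zp] := eqVneq z p.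
    rewrite zp Ep in wz *; have [->|wy] := eqVneq w y; first by rewrite Ey.
    have wp : w != p by apply: contraTneq (U_Nplus wz) => ->; rewrite ltnn.
    rewrite Ez // ltn_neqAle ymin // andbT.
    by apply: contra_neq wy => /val_inj/injS.
  rewrite (Ez z) //; have [wp|wp] := eqVneq w p.
    by rewrite wp in wz *; rewrite Ep; apply: around.
  have [wy|wy] := eqVneq w y; last by rewrite Ez //; apply: sorted.
  by rewrite wy in wz *; rewrite Ey; apply: ltn_trans ltyp; apply: sorted.
- move=> w z yw uw zy; have Uyz := U_Nplus zy.
  have zp : z != p.
    by apply: contraTneq (ltn_trans Upy Uyz) => ->; rewrite ltnn.
  have zNy : z != y by apply: contraTneq Uyz => ->; rewrite ltnn.
  have wy : w != y by apply: contraTneq (U_Nplus yw) => ->; rewrite ltnn.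
  have ltyz : S y < S z by apply: sorted => //; apply: leq_trans up (ltnW Upy).
  rewrite (Ez z) //; have [->|wp] := eqVneq w p; first by rewrite Ep.
  by rewrite Ez //; apply: ltn_trans ltyz; apply: sorted.
Qed.

(** When [S] is not fixed, it may have to be regarded as being at the beginning
of the phase of an earlier cell [u'], the phase of [u] being over. *)
Lemma sliding_cases T S u p : sliding T S u p ->
  nps_step U S = S \/
  exists u' p' y, slides T S u' p' y /\ (u' = u /\ p' = p \/ U u' < U u).
Proof.
move=> sl; have [injS old [Sp up] sorted around] := sl.
case E: (active_cell U S) => [v|]; last by left; rewrite /nps_step E.
case/active_cellP: E => vv vmax; right.
have /(violatesP injS)[y0 y0v lty0] := vv.
have [y yv ymin] := arg_minnP (fun y => S y : nat) y0v.
have ltyv : S y < S v by apply: leq_ltn_trans lty0; apply: ymin.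
have [uv|vu] := leqP (U u) (U v).
  have vp := sliding_violates sl uv vv; rewrite vp in yv ymin ltyv.
  by exists u, p, y; split; [split | left].
exists v, v, y; split; [split => //; split => // | by right].
- by move=> z zv; apply: old; apply: ltn_trans zv vu.
- by split=> //; apply: old.
- move=> z w zv vz wz; have : ~~ violates S z.
    apply: contra_neqN zv => /vmax zv; apply/injU/val_inj/eqP.
    by rewrite eqn_leq zv vz.
  move/(violatesP injS) => H; rewrite ltnNge leq_eqVlt.
  apply/norP; split; last by apply/negP=> lt; apply: H; exists w.
  apply: contraTneq (U_Nplus wz) => /val_inj/injS ->.
  by rewrite ltnn.
- move=> w z /U_Nplus vw uw.
  by have := leq_trans vw uw; rewrite ltnn.
Qed.

(** The first phase, that of the last cell, is trivial since this cell has no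
successor. *)
Lemma sliding_start T : is_tableau T -> 0 < #|{: cell la}| ->
  exists u, sliding T T u u.
Proof.
move=> /tableau_inj injT /card_gt0P[x0 _].
have [u _ umax] := arg_maxnP (P := xpredT) (i0 := x0) (fun u => U u : nat) isT.
have {}umax z : U z <= U u by apply: umax.
exists u; split=> //.
- move=> z y zu uz _; case/eqP: zu; apply/injU/val_inj/eqP.
  by rewrite eqn_leq uz umax.
- move=> w y /U_Nplus wu uw; by have := leq_trans wu uw; rewrite ltnn.
Qed.

Lemma sliding_iter T i : is_tableau T -> 0 < #|{: cell la}| ->
  exists u p, sliding T (iter i (nps_step U) T) u p.
Proof.
move=> tT /(sliding_start tT)[u0 sl0].
elim: i => [|i [u [p sl]]] /=; first by exists u0, u0.
case: (sliding_cases sl) => [->|[u' [p' [y' [sl' _]]]]]; first by exists u, p.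
by rewrite (slides_step sl'); exists u', y'; apply: slides_next sl'.
Qed.

(** * Exchanges of two given entries *)

(** The step from [S] exchanges the entry [a] at [x] with the entry [b] at [y].
*)
Definition swaps S (a b : nat) x y : bool :=
  [&& entry S x == a, entry S y == b,
      entry (nps_step U S) x == b & entry (nps_step U S) y == a].

Lemma slides_swaps T S u p y' a b x y : slides T S u p y' -> a < b ->
  swaps S a b x y = [&& x == y', y == p, entry S y' == a & entry S p == b].
Proof.
move=> sl ab; rewrite /swaps (slides_step sl).
have [[injS _ _ _ _] yp ymin ltyp] := sl.
have yNp : y' != p by apply: contraTneq (U_Nplus yp) => ->; rewrite ltnn.
apply/and4P/and4P=> [[/eqP xa /eqP yb]|]; last first.
  case=> /eqP-> /eqP-> /eqP<- /eqP<-.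
  by rewrite /entry !ffunE !eqxx (negPf yNp); split.
rewrite /entry !ffunE -/(entry S x) -/(entry S y).
have nab : (b == a) = false by apply: gtn_eqF.
have [xp|xp] := eqVneq x p.
  rewrite xp in xa *; have [yp'|yp'] := eqVneq y p.
    by move: nab; rewrite -xa -yb yp' eqxx.
  have [yy'|yy'] := eqVneq y y'.
    subst y; move: ltyp ab.
    by rewrite -ltnS -/(entry S p) -/(entry S y') xa yb; lia.
  by rewrite -/(entry S y) yb nab.
have [xy'|xy'] := eqVneq x y'; last by rewrite -/(entry S x) xa eq_sym nab.
subst x; rewrite -/(entry S p) => /eqP pb _.
have yp' : y = p by apply/injS/val_inj/succn_inj; rewrite -/(entry S y) yb.
by rewrite yp' -xa -pb /entry !eqxx.
Qed.

Lemma swaps_slides T S u p a b x y : sliding T S u p -> a < b ->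
    swaps S a b x y ->
  exists u', [/\ slides T S u' y x, entry S x = a, entry T u' = b
               & u' = u /\ y = p \/ U u' < U u].
Proof.
move=> sl ab sw; case: (sliding_cases sl) => [fixS|[u' [p' [y' [sl' le]]]]].
  case/and4P: sw => /eqP xa _; rewrite fixS xa => /eqP ab'.
  by rewrite ab' ltnn in ab.
move: sw; rewrite (slides_swaps _ _ sl' ab).
case/and4P=> /eqP-> /eqP-> /eqP ya /eqP pb; exists u'; split=> //.
by rewrite -pb /entry; case: sl' => -[_ _ [-> _] _ _].
Qed.

(** From [S] on, the initial entry of [v] is never again exchanged with a smaller
entry that is at most [a]: either the phase of [v] is over, or the sliding entry
is now below or to the right of an entry [>= a], so that by the jeu de taquin
condition all its successors are larger than [a]. *)
Definition spent T v (a : nat) S : Prop :=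
  exists u p, sliding T S u p /\
    (U u < U v \/
     u = v /\ exists w, [/\ p \in Nplus w, U u <= U w & a <= entry S w]).

Lemma spent_le T v a a' S : a <= a' -> spent T v a' S -> spent T v a S.
Proof.
move=> aa' [u [p [sl H]]]; exists u, p; split=> //.
case: H => [|[-> [w [pw uw a'w]]]]; [by left | right; split=> //].
by exists w; split=> //; apply: leq_trans a'w.
Qed.

Lemma spent_step T v a S : spent T v a S -> spent T v a (nps_step U S).
Proof.
case=> u [p [sl H]].
case: (sliding_cases sl) => [->|[u' [p' [y [sl' le]]]]].
  by exists u, p.
rewrite (slides_step sl'); exists u', y.
split; first exact: slides_next sl'.
case: le => [[eu ep]|ltu]; last first.
  by left; case: H => [|[<- //]]; apply: ltn_trans.
subst u' p'; case: H => [|[<- [w [pw uw aw]]]]; [by left | right; split=> //].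
have [_ yp ymin ltyp] := sl'; have [_ _ [_ up] _ around] := sl.
exists p; split=> //; rewrite /entry ffunE eqxx.
by apply: leq_trans aw _; rewrite /entry ltnS ltnW // around.
Qed.

Lemma spent_iter T v a S i : spent T v a S -> spent T v a (iter i (nps_step U) S).
Proof. by move=> sp; elim: i => //= i; apply: spent_step. Qed.

Lemma spent_swaps T v a S x y : injective T -> a < entry T v ->
  spent T v a S -> ~~ swaps S a (entry T v) x y.
Proof.
move=> injT av [u [p [sl H]]]; apply/negP=> /(swaps_slides sl av).
case=> u' [sl' xa /succn_inj/val_inj/injT u'v le]; subst u'.
have [_ xy _ _] := sl'.
case: H => [uv|[uv [w [pw uw aw]]]]; case: le => [[e1 e2]|lt]; subst.
- by rewrite ltnn in uv.
- by have := ltn_trans lt uv; rewrite ltnn.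
- have [_ _ _ _ around] := sl.
  have : entry S w < entry S x by rewrite ltnS; apply: around.
  by rewrite ltnNge aw.
- by rewrite ltnn in lt.
Qed.

Lemma slides_spent T S u p y : slides T S u p y ->
  spent T u (entry S y) (exchange S p y).
Proof.
move=> sl; have [[_ _ [_ up] _ _] yp _ _] := sl.
exists u, y; split; first exact: slides_next sl.
by right; split=> //; exists p; split=> //; rewrite /entry ffunE eqxx.
Qed.

(** An exchange of two given entries, the smaller one first, happens at most once
in a run at given cells. *)
Lemma swaps_uniq T a b x y i j : is_tableau T -> a < b -> i < j ->
  swaps (iter i (nps_step U) T) a b x y ->
  ~~ swaps (iter j (nps_step U) T) a b x y.
Proof.
move=> tT ab ij; have /tableau_inj injT := tT.
have [|u [p sl]] := sliding_iter i tT; first by apply/card_gt0P; exists x.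
case/(swaps_slides sl ab) => u' [sl' xa Tu' _].
rewrite -(subnK ij) iterD iterS (slides_step sl') -Tu'.
apply: spent_swaps => //; first by rewrite Tu'.
by apply: spent_iter; rewrite -xa; apply: slides_spent sl'.
Qed.

(** * Independence of the larger entry *)

(** The tableau [S] with the entries of values [c] and [d] exchanged. *)
Definition relabel (c d : 'I_n) S : filling n la := [ffun z => tperm c d (S z)].

Lemma relabelE c d S z : relabel c d S z = tperm c d (S z).
Proof. by rewrite ffunE. Qed.

Lemma relabelK c d : involutive (relabel c d).
Proof. by move=> S; apply/ffunP=> z; rewrite !ffunE tpermK. Qed.

Lemma relabel_tableau c d S : is_tableau S -> is_tableau (relabel c d S).
Proof.
case/andP=> /injectiveP injS /forallP surS; apply/andP; split.
  by apply/injectiveP=> z w; rewrite !ffunE => /perm_inj/injS.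
apply/forallP=> k; have /codomP[z zk] := surS (tperm c d k).
by apply/codomP; exists z; rewrite ffunE -zk tpermK.
Qed.

Lemma relabel_exchange c d S x y :
  relabel c d (exchange S x y) = exchange (relabel c d S) x y.
Proof. by apply/ffunP=> z; rewrite ffunE !exchange_tperm ffunE. Qed.

Definition adjacent (c d : 'I_n) : Prop := c.+1 = d \/ d.+1 = c.

Lemma tperm_adjacent (c d k l : 'I_n) : adjacent c d -> k != c -> l != c ->
  k < l -> tperm c d k < tperm c d l.
Proof.
move=> cd kc lc kl.
have neq (i j : 'I_n) : i != j -> (i : nat) <> j.
  by move=> ij /val_inj/eqP; apply/negP.
move/neq: (kc) (neq _ _ lc) kl; rewrite !permE /= (negPf kc) (negPf lc).
case: (eqVneq k d) => [->|/neq]; case: (eqVneq l d) => [->|/neq]; case: cd; lia.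
Qed.

(** Relabelling commutes with a step up to the end of the phase of [v], unless
the step is an exchange of the two relabelled values. Indeed, [T v] is then at
[p] or before [u], so the relabelling preserves all comparisons from [u] on that
matter for the step. *)
Lemma relabel_step T S u p y v d : injective T -> slides T S u p y ->
    adjacent (T v) d -> U v <= U u -> (S p = T v -> S y <> d) ->
  nps_step U (relabel (T v) d S) = relabel (T v) d (nps_step U S).
Proof.
move=> injT slS cd vu nd; rewrite (slides_step slS) relabel_exchange.
have [[injS old [Sp up] sorted around] yp ymin ltyp] := slS.
(* From [u] on, only [p] can hold the relabelled value [T v]. *)
have Nc z : U u <= U z -> z != p -> S z != T v.
  move=> uz zp; apply/eqP=> Szv; move: vu; rewrite leq_eqVlt => /orP[/eqP e|lt].
    have vu : v = u by apply/injU/val_inj.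
    by move: Szv; rewrite vu -Sp => /injS; apply/eqP.
  have := old v lt; rewrite -Szv => /injS vz; subst.
  by have := leq_trans lt uz; rewrite ltnn.
have Np z : z \in Nplus p -> z != p.
  by move=> /U_Nplus H; apply: contraTneq H => ->; rewrite ltnn.
have uNp z : z \in Nplus p -> U u <= U z.
  by move=> /U_Nplus/ltnW; apply: leq_trans.
have ltyp' : relabel (T v) d S y < relabel (T v) d S p.
  rewrite !ffunE; have [Spv|Spv] := eqVneq (S p) (T v); last first.
    by apply: tperm_adjacent => //; apply: Nc (Np _ yp); apply: uNp.
  rewrite Spv tpermL; have yd := nd Spv; rewrite Spv in ltyp.
  have ydn : (S y : nat) <> d by move=> /val_inj.
  rewrite tpermD; [by case: cd; lia | | by apply/eqP=> e; apply: yd].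
  by apply: contraTneq ltyp => <-; rewrite ltnn.
apply: nps_step_exchange => //.
- by move=> z w; rewrite !ffunE => /perm_inj/injS.
- move=> z zp; rewrite !ffunE.
  have [->//|zy] := eqVneq z y.
  apply/ltnW/tperm_adjacent; rewrite ?Nc ?Np ?uNp //.
  rewrite ltn_neqAle ymin // andbT.
  by apply: contra_neq zy => /val_inj/injS.
- have injR : injective (relabel (T v) d S).
    by move=> z w; rewrite !ffunE => /perm_inj/injS.
  move=> z /(violatesP injR)[w wz]; rewrite !ffunE => lt.
  have [uz|zu] := leqP (U u) (U z); last by apply: leq_trans (ltnW zu) up.
  have [->//|zp] := eqVneq z p.
  have ltzw := sorted _ _ zp uz wz.
  have uw : U u <= U w by apply: leq_trans uz (ltnW (U_Nplus wz)).
  suff : tperm (T v) d (S z) < tperm (T v) d (S w).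
    by move=> /(ltn_trans lt); rewrite ltnn.
  have [wp|wp] := eqVneq w p; last by apply: tperm_adjacent; rewrite ?Nc.
  subst w; have [Spv|Spv] := eqVneq (S p) (T v); last first.
    by apply: tperm_adjacent => //; apply: Nc.
  (* [S z < S y < T v] leaves no room for [S z = d]. *)
  have ltzy := around _ _ wz uz yp.
  rewrite Spv tpermL; rewrite Spv in ltyp ltzw.
  have zd : (S z : nat) <> d by case: cd; lia.
  rewrite tpermD; [by case: cd; lia | | by apply/eqP=> e; apply: zd; rewrite e].
  by apply: contraTneq ltzw => <-; rewrite ltnn.
Qed.

(** An exchange of [T v] with [a] in the run from [S] has a counterpart in the
relabelled run. The index [j] may differ from [i], so that steps fixing [S] can
be skipped. *)
Lemma relabel_swaps T v d a i S u p x y : injective T ->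
    adjacent (T v) d -> a < entry T v -> a < d.+1 -> sliding T S u p ->
    swaps (iter i (nps_step U) S) a (entry T v) x y ->
  exists j, swaps (iter j (nps_step U) (relabel (T v) d S)) a d.+1 x y.
Proof.
move=> injT cd av ad; elim: i S u p => [|i IHi] S u p sl.
  move=> /= sw; exists 0 => /=; have sw' := sw.
  case/(swaps_slides sl av): sw' => u' [sl' xa].
  move=> /succn_inj/val_inj/injT uv _; subst u'.
  have yd : S x <> d by move=> xd; rewrite /entry xd in xa; rewrite xa ltnn in ad.
  have Sy : S y = T v by case: sl' => -[_ _ [-> _]].
  have Sx : tperm (T v) d (S x) = S x.
    rewrite tpermD //; last by apply/eqP=> e; apply: yd.
    by apply: contraTneq av => e; rewrite /entry e -xa ltnn.
  rewrite /swaps (relabel_step injT sl') // (slides_step sl') /entry !relabelE.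
  by rewrite !exchange_tperm !(tpermL y x) !(tpermR y x) Sy tpermL Sx -xa !eqxx.
rewrite iterSr => sw.
case: (sliding_cases sl) => [fixS|[u' [p' [y' [sl' le]]]]].
  by rewrite fixS in sw; apply: IHi sl sw.
have E := slides_step sl'.
(* If the phase of [v] is over, or [T v] has been exchanged with [d > a], then no
   exchange of [T v] with [a] can follow. *)
have [vu|uv] := leqP (U v) (U u'); last first.
  have sp : spent T v a (nps_step U S).
    by rewrite E; exists u', y'; split; [apply: slides_next sl' | left].
  by have := spent_swaps x y injT av (spent_iter i sp); rewrite sw.
have [/andP[/eqP pv /eqP yd]|nd] := boolP ((S p' == T v) && (S y' == d)).
  have uv : u' = v by apply: injT; rewrite -pv; case: sl' => -[_ _ [-> _]].
  subst u'; have sp : spent T v a (nps_step U S).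
    by rewrite E; apply: (spent_le (a' := entry S y')); 
       [rewrite /entry yd ltnW | apply: slides_spent sl'].
  by have := spent_swaps x y injT av (spent_iter i sp); rewrite sw.
have [|j swj] := IHi (nps_step U S) u' y' _ sw.
  by rewrite E; apply: slides_next sl'.
exists j.+1; rewrite iterSr (relabel_step injT sl') //.
by move=> pv yd; rewrite pv yd !eqxx in nd.
Qed.

(** Exchanges occur only before the first standard tableau. If the orbit had no
standard tableau, [nps_rounds] would be its length, and any exchange would
already occur in the first pass through the orbit. *)
Lemma swaps_rounds T a b x y i : a < b ->
  swaps (iter i (nps_step U) T) a b x y ->
  [exists j : 'I_(nps_rounds U T), swaps (iter j (nps_step U) T) a b x y].
Proof.
move=> ab; have C := fconnect_iter (nps_step U) i T.
rewrite -(iter_findex C); have := findex_max C; set j := findex _ _ _ => jo sw.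
suff jr : j < nps_rounds U T by apply/existsP; exists (Ordinal jr).
rewrite ltnNge; apply/negP=> rj.
have ro : nps_rounds U T < order (nps_step U) T by apply: leq_ltn_trans rj jo.
have : has (@is_SYT n la) (orbit (nps_step U) T).
  by rewrite has_find size_orbit.
move/(nth_find T); rewrite -/(nps_rounds U T) nth_traject // => std.
have fixj : iter j (nps_step U) T = iter (nps_rounds U T) (nps_step U) T.
  rewrite -(subnK rj) iterD; elim: (j - _) => //= k ->.
  exact: nps_step_standard.
move: sw; rewrite /swaps fixj nps_step_standard // => /and4P[/eqP-> _ /eqP e _].
by rewrite e ltnn in ab.
Qed.

Lemma exchange_numberE a b x y :
  exchange_number U a b x y =
  #|[set T | is_tableau T &
      [exists j : 'I_(nps_rounds U T), swaps (iter j (nps_step U) T) a b x y]]|.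
Proof. by []. Qed.

Lemma exchange_number_adjacent_le a (c d : 'I_n) x y :
  adjacent c d -> a < c.+1 -> a < d.+1 ->
  exchange_number U a c.+1 x y <= exchange_number U a d.+1 x y.
Proof.
move=> cd ac ad; rewrite !exchange_numberE.
rewrite -(card_imset _ (can_inj (relabelK c d))); apply/subset_leq_card/subsetP.
move=> _ /imsetP[T + ->]; rewrite !inE => /andP[tT /existsP[j sw]].
rewrite relabel_tableau //=; have /tableau_inj injT := tT.
have /codomP[v cv] : c \in codom T by case/andP: tT => _ /forallP.
subst c; have [|u sl] := sliding_start tT; first by apply/card_gt0P; exists x.
have [i swi] := relabel_swaps injT cd ac ad sl sw.
exact: swaps_rounds swi.
Qed.

Lemma exchange_number_indep a b b' x y : a < b <= n -> a < b' <= n ->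
  exchange_number U a b x y = exchange_number U a b' x y.
Proof.
suff H c : a < c <= n -> exchange_number U a c x y = exchange_number U a a.+1 x y.
  by move=> /H-> /H->.
elim: c => [|c IHc /andP[]]; first by rewrite ltn0.
rewrite ltnS leq_eqVlt => /orP[/eqP-> _|ac cn]; first by [].
have an : a < c <= n by rewrite ac ltnW.
rewrite -(IHc an); case: c ac cn {IHc an} => [|c] ac cn.
  by rewrite ltn0 in ac.
pose i := Ordinal (ltnW cn); pose j := Ordinal cn.
have ij : adjacent i j by left.
have ji : adjacent j i by right.
have aj : a < j.+1 by apply: ltnW.
apply/eqP; rewrite eqn_leq.
by rewrite (exchange_number_adjacent_le x y ji aj ac)
  (exchange_number_adjacent_le x y ij ac aj).
Qed.

(** * Counting tableaux and exchanges *)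

Lemma card_cell : #|{: cell la}| = n.
Proof.
case/andP: stdU => /andP[_ /forallP surU] _.
by rewrite -(card_codom injU) -[RHS]card_ord; apply: eq_card => k; rewrite surU.
Qed.

Lemma card_tableaux : #|[set T : filling n la | is_tableau T]| = n`!.
Proof.
have -> : [set T : filling n la | is_tableau T] = [set T : filling n la | injectiveb T].
  apply/setP=> T; rewrite !inE /is_tableau.
  case: injectiveP => //= injT; apply/forallP=> k.
  by apply: inj_card_onto; rewrite ?card_cell ?card_ord.
by rewrite card_inj_ffuns card_cell card_ord ffactnn.
Qed.

(** Relabelling shows that every value occurs equally often at [x]. *)
Lemma card_tableaux_entry x b : 0 < b <= n ->
  #|[set T : filling n la | is_tableau T & entry T x == b]| = (n.-1)`!.
Proof.
case: b => // b bn.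
pose N k := #|[set T : filling n la | is_tableau T & T x == k]|.
have Nle k l : N k <= N l.
  rewrite /N -(card_imset _ (can_inj (relabelK k l))).
  apply/subset_leq_card/subsetP => _ /imsetP[T + ->]; rewrite !inE.
  by case/andP=> tT /eqP Tk; rewrite relabel_tableau //= relabelE Tk tpermL.
have total : \sum_(k < n) N k = n`!.
  rewrite -card_tableaux -sum1_card (partition_big (fun T : filling n la => T x) xpredT) //=.
  by apply: eq_bigr => k _; rewrite /N -sum1_card; apply: eq_bigl => T; rewrite !inE.
have Nb k : N k = N (Ordinal bn) by apply/eqP; rewrite eqn_leq !Nle.
have -> : #|[set T : filling n la | is_tableau T & entry T x == b.+1]| = N (Ordinal bn).
  by apply: eq_card => T; rewrite !inE.
have n0 : 0 < n := leq_ltn_trans (leq0n b) bn.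
move: (N (Ordinal bn)) Nb => M Nb.
have : n * M = n * (n.-1)`!.
  rewrite -[in RHS](prednK n0) -factS prednK // -total (eq_bigr (fun _ => M)) //.
  by rewrite sum_nat_const card_ord.
by move/eqP; rewrite eqn_pmul2l // => /eqP.
Qed.

Lemma exchange_number_sum a b x y : a < b ->
  exchange_number U a b x y =
  \sum_(T : filling n la | is_tableau T)
     \sum_(0 <= i < nps_rounds U T) swaps (iter i (nps_step U) T) a b x y.
Proof.
move=> ab; rewrite exchange_numberE -sum1_card.
under eq_bigl do rewrite inE.
rewrite big_mkcondr; apply: eq_bigr => T tT; rewrite big_mkord.
case: existsP => [[i swi]|no].
  rewrite (bigD1 i) //= swi big1 // => j ji; apply/eqP; rewrite eqb0.
  have [ij|lt|/val_inj e] := ltngtP i j.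
  - exact: swaps_uniq tT ab ij swi.
  - by apply: contraL swi; apply: swaps_uniq.
  - by rewrite e eqxx in ji.
rewrite big1 // => i _; apply/eqP; rewrite eqb0.
by apply/negP=> sw; apply: no; exists i.
Qed.

End Sliding.

(** * The balance of an entry at a cell *)

Section Flow.
Variables (n : nat) (la : seq nat) (U : filling n la).
Hypothesis stdU : is_SYT U.
Implicit Types (S T : filling n la) (x y z u p : cell la).

(** The contribution of the step from [S] to the exchange numbers with larger
entry [c]; the order of arguments suits [signed_exit]. *)
Definition swap_count S (c a : nat) x y : nat := swaps U S a c x y.

Lemma signed_exit_slides T S u p y a c x : slides U T S u p y -> (a < c)%N ->
  signed_exit (swap_count S c) a x =
  ((a == entry S y) && (c == entry S p))%:Z * ((x == y)%:Z - (x == p)%:Z).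
Proof.
move=> sl ac; have [_ yp _ _] := sl; rewrite /signed_exit /swap_count.
rewrite [a == _]eq_sym [c == _]eq_sym mulrBr; congr (_ - _).
  under eq_bigr => z _ do rewrite (slides_swaps stdU _ _ sl ac).
  have [->|xy] := eqVneq x y; last by rewrite mulr0 big1.
  rewrite (bigD1 p) ?mem_Nminus //= eqxx mulr1 big1 ?addr0 // => z /andP[_ zp].
  by rewrite (negPf zp).
under eq_bigr => z _ do rewrite (slides_swaps stdU _ _ sl ac).
have [->|xp] := eqVneq x p; last by rewrite mulr0 big1 // => z _; rewrite andbF.
rewrite (bigD1 y) //= eqxx mulr1 big1 ?addr0 // => z /andP[_ zy].
by rewrite (negPf zy).
Qed.

(** The net loss of the entry [b] at [x] in one step. *)
Lemma step_flow T S u p b x : sliding U T S u p -> (0 < b <= n)%N ->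
  (entry S x == b)%:Z - (entry (nps_step U S) x == b)%:Z =
  \sum_(b.+1 <= c < n.+1) signed_exit (swap_count S c) b x
  - \sum_(1 <= a < b) signed_exit (swap_count S b) a x.
Proof.
move=> sl /andP[b0 bn]; case: (sliding_cases stdU sl) => [fixS|[u' [p' [y [sl' _]]]]].
  have Z a c : (a < c)%N -> signed_exit (swap_count S c) a x = 0.
    move=> ac; have Z y z : swap_count S c a y z = 0%N.
      rewrite /swap_count /swaps fixS; apply/eqP; rewrite eqb0; apply/negP.
      by case/and4P=> /eqP-> _ /eqP e; rewrite e ltnn in ac.
    by rewrite /signed_exit !big1 // => y _; rewrite Z.
  rewrite fixS subrr big_nat_cond big1 => [|c /andP[/andP[bc _] _]]; last exact: Z.
  by rewrite big_nat_cond big1 ?subrr // => a /andP[/andP[_ ab] _]; apply: Z.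
have [_ yp _ ltyp] := sl'.
have {}ltyp : (entry S y < entry S p')%N by rewrite ltnS.
have yNp : y != p'.
  by apply: contraTneq (standard_Nplus stdU yp) => ->; rewrite ltnn.
have -> : \sum_(b.+1 <= c < n.+1) signed_exit (swap_count S c) b x =
    (b == entry S y)%:Z * ((x == y)%:Z - (x == p')%:Z).
  rewrite (eq_big_nat _ _ (F2 := fun c => if c == entry S p' then
     (b == entry S y)%:Z * ((x == y)%:Z - (x == p')%:Z) else 0)); last first.
    move=> c /andP[bc _]; rewrite (signed_exit_slides _ sl' bc).
    by case: (c == _); rewrite ?andbT // andbF mul0r.
  rewrite -big_mkcond big_nat1_eq; have [->|_] := eqVneq b (entry S y).
    by rewrite ltyp /entry ltnS ltn_ord.
  by rewrite mul0r if_same.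
have -> : \sum_(1 <= a < b) signed_exit (swap_count S b) a x =
    (b == entry S p')%:Z * ((x == y)%:Z - (x == p')%:Z).
  rewrite (eq_big_nat _ _ (F2 := fun a => if a == entry S y then
     (b == entry S p')%:Z * ((x == y)%:Z - (x == p')%:Z) else 0)); last first.
    move=> a /andP[_ ab]; rewrite (signed_exit_slides _ sl' ab).
    by case: (a == _); rewrite //= mul0r.
  rewrite -big_mkcond big_nat1_eq; have [->|_] := eqVneq b (entry S p').
    by rewrite ltyp.
  by rewrite mul0r if_same.
rewrite (slides_step stdU sl') /entry ffunE ![b == _]eq_sym.
have [->|xp] := eqVneq x p'; first rewrite [p' == y]eq_sym (negPf yNp).
  by rewrite sub0r !mulrN1 opprK addrC.
have [->|xy] := eqVneq x y; first by rewrite subr0 !mulr1.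
by rewrite !subrr !mulr0 subrr.
Qed.

Lemma signed_exit_sum (c a : nat) x : (a < c)%N ->
  signed_exit (fun a => exchange_number U a c) a x =
  \sum_(T : filling n la | is_tableau T) \sum_(0 <= i < nps_rounds U T)
     signed_exit (swap_count (iter i (nps_step U) T) c) a x.
Proof.
move=> ac; have E y z : (exchange_number U a c y z)%:Z =
    \sum_(T : filling n la | is_tableau T) \sum_(0 <= i < nps_rounds U T)
      (swap_count (iter i (nps_step U) T) c a y z)%:Z.
  rewrite exchange_number_sum // (big_morph Posz PoszD (erefl _)).
  by apply: eq_bigr => T _; rewrite (big_morph Posz PoszD (erefl _)).
rewrite /signed_exit; under eq_bigr => y _ do rewrite E.
under [X in _ - X]eq_bigr => y _ do rewrite E.
rewrite exchange_big [X in _ - X]exchange_big -sumrB; apply: eq_bigr => T _.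
by rewrite exchange_big [X in _ - X]exchange_big -sumrB.
Qed.

(** The net loss of the entry [b] at [x] over all runs. *)
Lemma exit_balance b x : (0 < b <= n)%N ->
  ((n.-1)`!)%:Z - (omega U b x)%:Z =
  \sum_(b.+1 <= c < n.+1) signed_exit (fun a => exchange_number U a c) b x
  - \sum_(1 <= a < b) signed_exit (fun a => exchange_number U a b) a x.
Proof.
move=> hb; rewrite -(card_tableaux_entry stdU x hb) /omega.
have C (P : pred (filling n la)) :
    #|[set T | is_tableau T & P T]|%:Z = \sum_(T | is_tableau T) (P T)%:Z.
  rewrite -sum1_card; under eq_bigl do rewrite inE.
  rewrite big_mkcondr (big_morph Posz PoszD (erefl _)).
  by apply: eq_bigr => T _; case: (P T).
rewrite !C -sumrB.
transitivity (\sum_(T : filling n la | is_tableau T)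
    \sum_(0 <= i < nps_rounds U T)
    (\sum_(b.+1 <= c < n.+1) signed_exit (swap_count (iter i (nps_step U) T) c) b x
     - \sum_(1 <= a < b) signed_exit (swap_count (iter i (nps_step U) T) b) a x)).
  apply: eq_bigr => T tT; rewrite /nps /nps_iter.
  pose f i := - (entry (iter i (nps_step U) T) x == b)%:Z.
  transitivity (f (nps_rounds U T) - f 0%N); first by rewrite /f opprK addrC.
  rewrite -telescope_sumr //; apply: eq_bigr => i _.
  have [|u [p sl]] := sliding_iter stdU i tT; first by apply/card_gt0P; exists x.
  by rewrite -(step_flow x sl hb) /f opprK addrC.
under eq_bigr do rewrite sumrB.
rewrite sumrB; congr (_ - _).
  under eq_bigr do rewrite exchange_big.
  rewrite exchange_big; apply: eq_big_nat => c /andP[bc _].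
  by rewrite signed_exit_sum.
under eq_bigr do rewrite exchange_big.
rewrite exchange_big; apply: eq_big_nat => a /andP[_ ab].
by rewrite signed_exit_sum.
Qed.

End Flow.

Unset Implicit Arguments.

Theorem theorem5p3 (n : nat) (la : seq nat) (hla : is_partition n la)
    (U : filling n la) (hU : is_SYT U)
    (m : nat -> cell la -> cell la -> nat)
    (hm : is_local_exchange_number U m)
    (x : cell la) (b : nat) (hb : (1 <= b <= n)%N) :
  (n%:Z - b%:Z) * signed_exit m b x =
    ((n.-1)`!)%:Z - (omega U b x)%:Z + \sum_(1 <= a < b) signed_exit m a x.
Proof.
have mE a c y z : (0 < a)%N -> (a < c <= n)%N -> m a y z = exchange_number U a c y z.
  move=> a0 /andP[ac cn]; have an : (0 < a < n)%N by rewrite a0 (leq_trans ac).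
  have [c' c'n ->] := hm _ y z an.
  by apply: exchange_number_indep; rewrite ?ac.
have signedE a c : (0 < a)%N -> (a < c <= n)%N ->
    signed_exit (fun a => exchange_number U a c) a x = signed_exit m a x.
  move=> a0 acn; rewrite /signed_exit.
  by congr (_ - _); apply: eq_bigr => y _; rewrite (mE _ c).
have [b0 bn] := andP hb.
rewrite (exit_balance hU x hb).
rewrite [X in _ = _ - X + _](_ : _ = \sum_(1 <= a < b) signed_exit m a x).
  rewrite subrK (eq_big_nat _ _ (F2 := fun _ => signed_exit m b x)).
    by rewrite sumr_const_nat subSS subzn // -mulr_natl natz.
  by move=> c /andP[bc cn]; apply: signedE; rewrite ?bc.
by apply: eq_big_nat => a /andP[a0 ab]; apply: signedE; rewrite ?ab.
Qed.
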